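(* Let $\mathscr{G}$ be a faithfully representable Lie groupoid, let $K$ be a compact Lie group and let $\rho\in\hom(K,\mathscr{G})$ be a monomorphism. Then there exists a faithful character $\chi$ of the Lie group $K$ such that $\chi\circ\mu=\chi$ for any $\mu\in\mathrm{Mon}(\mathscr{G};\rho)$.
   Context: Lie groupoids: a $C^\infty$-space is a topological space with a $C^\infty$-atlas of constant dimension (possibly non-Hausdorff); a smooth manifold is a Hausdorff second-countable $C^\infty$-space. A Lie groupoid $\mathscr{G}$ is a groupoid whose arrow set $\mathscr{G}_1$ (also written $\mathscr{G}$) and object set $\mathscr{G}_0$ are $C^\infty$-spaces, with all structure maps smooth, with surjective submersive source map, and such that $\mathscr{G}_0$ and all source-fibers are smooth manifolds ($\mathscr{G}_1$ need not be Hausdorff). Source and target are denoted $\mathrm{s},\mathrm{t}$. The isotropy group at $x\in\mathscr{G}_0$ is the Lie group $\mathrm{I}_x(\mathscr{G})$ of arrows from $x$ to $x$. Representations: for a smooth complex vector bundle $\mathsf{V}\to M$ of finite rank, $\mathrm{GL}(\mathsf{V})$ is the Lie groupoid over $M$ whose arrows from $x$ to $x'$ are the linear isomorphisms $\mathsf{V}_x\to\mathsf{V}_{x'}$. A representation of $\mathscr{G}$ is a smooth complex vector bundle $\mathsf{V}\to\mathscr{G}_0$ of finite rank with a homomorphism of Lie groupoids $r:\mathscr{G}\to\mathrm{GL}(\mathsf{V})$ which is the identity on objects; it is faithful if $r$ is injective. $\mathscr{G}$ is faithfully representable if it admits a faithful representation. Monodromy group: $\hom(K,\mathscr{G})$ is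 the set of all continuous groupoid homomorphisms $\varphi$ from $K$ (viewed as a groupoid with one object) to $\mathscr{G}$, i.e. pairs of a point $\omega(\varphi)\in\mathscr{G}_0$ and a continuous group homomorphism $\varphi:K\to\mathrm{I}_{\omega(\varphi)}(\mathscr{G})$, with the compact-open topology (as a subspace of the space $C(K,\mathscr{G})$ of continuous maps $K\to\mathscr{G}_1$). $\mathscr{G}$ acts on $\hom(K,\mathscr{G})$ from the left along $\omega$ by $(g\varphi)(k)=g\varphi(k)g^{-1}$ for $g\in\mathscr{G}$ with $\mathrm{s}(g)=\omega(\varphi)$. $\hom(K,\mathscr{G};\rho)$ is the smallest subset of $\hom(K,\mathscr{G})$ which contains $\rho$, is a union of path-components of $\hom(K,\mathscr{G})$ and is invariant under the $\mathscr{G}$-action. With $\mathrm{Aut}(K)$ the group of automorphisms of the topological group $K$, $$\mathrm{Mon}(\mathscr{G};\rho)=\{\mu\in\mathrm{Aut}(K)\;|\;\hom(K,\mathscr{G};\rho)\circ\mu=\hom(K,\mathscr{G};\rho)\}.$$ A monomorphism is an injective homomorphism. A character of a Lie group is the trace function of a finite-dimensional complex (continuous) representation; it is faithful if it is the character of a faithful representation. *)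

(* Defs.v *)
From HB Require Import structures.
From mathcomp Require Import all_boot all_order all_algebra.
From mathcomp Require Import all_classical all_reals all_analysis.
From mathcomp Require Import complex.

Set Implicit Arguments.
Unset Strict Implicit.
Unset Printing Implicit Defensive.

Import Order.TTheory GRing.Theory Num.Theory.
Import numFieldNormedType.Exports.

Local Open Scope classical_set_scope.
Local Open Scope ring_scope.

(* C^k regularity on U; only used for U open. *)
Fixpoint Ck_on (R : realType) (V W : normedModType R) (k : nat) (U : set V)
    (f : V -> W) : Prop :=
  if k is k'.+1 then
    (forall x, U x -> differentiable f x) /\
    (forall v : V, Ck_on k' U ('D_v f))
  else forall x, U x -> {for x, continuous f}.

Definition Cinfty_on (R : realType) (V W : normedModType R) (U : set V)
    (f : V -> W) : Prop := forall k, Ck_on k U f.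

(* The values of [chart_map] outside [chart_dom] are irrelevant. *)
Record chart (R : realType) (T : topologicalType) (n : nat) := Chart {
  chart_dom : set T;
  chart_map : T -> 'rV[R]_n }.

Definition is_chart (R : realType) (T : topologicalType) (n : nat)
    (c : chart R T n) : Prop :=
  [/\ open (chart_dom c),
      {in chart_dom c &, injective (chart_map c)},
      forall x, chart_dom c x -> {for x, continuous (chart_map c)} &
      forall A, open A -> A `<=` chart_dom c -> open (chart_map c @` A)].

Record chartedSpace (R : realType) := ChartedSpace {
  cs_sort :> topologicalType;
  cs_dim : nat;
  cs_atlas : set (chart R cs_sort cs_dim) }.

Arguments cs_atlas {R}.

Section SmoothMaps.
Context {R : realType}.
Implicit Types X Y : chartedSpace R.

(* [F] expresses [f], restricted to [U], in the charts [c] and [c']; it is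
   determined by this on [chart_image U f c c']. *)
Definition local_expr X Y (U : set X) (f : X -> Y)
    (c : chart R X (cs_dim X)) (c' : chart R Y (cs_dim Y))
    (F : 'rV[R]_(cs_dim X) -> 'rV[R]_(cs_dim Y)) : Prop :=
  forall x, U x -> chart_dom c x -> chart_dom c' (f x) ->
    F (chart_map c x) = chart_map c' (f x).

Definition chart_image X Y (U : set X) (f : X -> Y)
    (c : chart R X (cs_dim X)) (c' : chart R Y (cs_dim Y)) :
    set 'rV[R]_(cs_dim X) :=
  chart_map c @` (U `&` chart_dom c `&` f @^-1` chart_dom c').

(* only used for U open *)
Definition smooth_open X Y (U : set X) (f : X -> Y) : Prop :=
  (forall x, U x -> {for x, continuous f}) /\
  (forall c c', cs_atlas X c -> cs_atlas Y c' ->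
    exists2 F, local_expr U f c c' F & Cinfty_on (chart_image U f c c') F).

Definition smooth X Y (f : X -> Y) : Prop := smooth_open setT f.

(* Smoothness on an arbitrary subset, by local smooth extension; when [A] is an
   embedded submanifold this is smoothness for the induced structure. *)
Definition smooth_on X Y (A : set X) (f : X -> Y) : Prop :=
  forall x, A x -> exists U : set X, exists h : X -> Y,
    [/\ open U, U x, smooth_open U h & {in A `&` U, f =1 h}].

Definition submersion X Y (f : X -> Y) : Prop :=
  smooth f /\
  forall c c' x F, cs_atlas X c -> cs_atlas Y c' ->
    chart_dom c x -> chart_dom c' (f x) -> local_expr setT f c c' F ->
    forall w, exists v, 'd F (chart_map c x) v = w.

Definition cinfty_space X : Prop :=
  [/\ forall c, cs_atlas X c -> is_chart c,
      forall x : X, exists2 c, cs_atlas X c & chart_dom c x &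
      forall c c', cs_atlas X c -> cs_atlas X c' ->
        exists2 F, local_expr (X := X) (Y := X) setT id c c' F &
                   Cinfty_on (chart_image (X := X) (Y := X) setT id c c') F].

Definition smooth_manifold X : Prop :=
  [/\ cinfty_space X, hausdorff_space X & @second_countable X].

Definition euclidean (n : nat) : chartedSpace R :=
  @ChartedSpace R 'rV[R]_n n [set Chart setT id].

Definition prod_chart X Y (c : chart R X (cs_dim X))
    (c' : chart R Y (cs_dim Y)) :
    chart R (X * Y)%type (cs_dim X + cs_dim Y) :=
  Chart (chart_dom c `*` chart_dom c')
        (fun p => row_mx (chart_map c p.1) (chart_map c' p.2)).

Definition prod_space X Y : chartedSpace R :=
  @ChartedSpace R (X * Y)%type (cs_dim X + cs_dim Y)
    [set prod_chart c c' | c in cs_atlas X & c' in cs_atlas Y].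

End SmoothMaps.

(* [gcomp g h] is the product g h; its value is irrelevant unless
   [src g = tgt h]. *)
Record groupoidData (R : realType) := GroupoidData {
  arr : chartedSpace R;
  ob : chartedSpace R;
  src : arr -> ob;
  tgt : arr -> ob;
  idarr : ob -> arr;
  gcomp : arr -> arr -> arr;
  invarr : arr -> arr }.

Arguments src {R g}.
Arguments tgt {R g}.
Arguments idarr {R g}.
Arguments gcomp {R g}.
Arguments invarr {R g}.

Section LieGroupoids.
Context {R : realType}.

Definition is_groupoid (G : groupoidData R) : Prop :=
  [/\ (forall x : ob G, src (idarr x) = x /\ tgt (idarr x) = x),
      (forall g h : arr G, src g = tgt h ->
         src (gcomp g h) = src h /\ tgt (gcomp g h) = tgt g),
      (forall g h k : arr G, src g = tgt h -> src h = tgt k ->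
         gcomp g (gcomp h k) = gcomp (gcomp g h) k),
      (forall g : arr G, gcomp g (idarr (src g)) = g /\
                         gcomp (idarr (tgt g)) g = g) &
      (forall g : arr G,
         [/\ src (invarr g) = tgt g, tgt (invarr g) = src g,
             gcomp g (invarr g) = idarr (tgt g) &
             gcomp (invarr g) g = idarr (src g)])].

(* As [src] is a submersion, its fibers are embedded in [arr G], and hence are
   C^oo-spaces for the subspace topology; what remains to be required for them to be
   smooth manifolds is the last condition.  Likewise the set of composable
   pairs is embedded in [arr G * arr G]. *)
Definition is_lie_groupoid (G : groupoidData R) : Prop :=
  is_groupoid G /\
  [/\ cinfty_space (arr G),
      smooth_manifold (ob G),
      submersion (@src R G) /\ (forall x : ob G, exists g, src g = x),
      [/\ smooth (@tgt R G), smooth (@idarr R G), smooth (@invarr R G) &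
          smooth_on (X := prod_space (arr G) (arr G))
            [set p | src p.1 = tgt p.2] (fun p => gcomp p.1 p.2)] &
      forall x : ob G,
        hausdorff_space (src @^-1` [set x] : set (arr G)) /\
        @second_countable (src @^-1` [set x] : set (arr G))].

Definition is_lie_groupoid_hom (G H : groupoidData R) (f0 : ob G -> ob H)
    (f : arr G -> arr H) : Prop :=
  [/\ smooth f0, smooth f,
      (forall g, src (f g) = f0 (src g) /\ tgt (f g) = f0 (tgt g)),
      (forall x, f (idarr x) = idarr (f0 x)) &
      (forall g h, src g = tgt h -> f (gcomp g h) = gcomp (f g) (f h))].

End LieGroupoids.

Definition mx_coords (R : realType) (d : nat) (A : 'M[R[i]]_d) :
    'rV[R]_(d * d + d * d) :=
  row_mx (mxvec (map_mx (@complex.Re R) A)) (mxvec (map_mx (@complex.Im R) A)).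

(* The values of [triv_map] outside [triv_dom] are irrelevant. *)
Record trivialization (R : realType) (M : Type) (V : M -> lmodType R[i])
    (d : nat) := Trivialization {
  triv_dom : set M;
  triv_map : forall x, V x -> 'cV[R[i]]_d }.

(* A smooth complex vector bundle of rank d over M, given by its fibers and a
   vector bundle atlas, which determines the smooth structure of the total
   space.  The rank is constant, for GL(V) to have constant dimension. *)
Record vectorBundle (R : realType) (M : chartedSpace R) (d : nat) :=
    VectorBundle {
  fiber : M -> lmodType R[i];
  trivs : set (trivialization fiber d);
  triv_open : forall P, trivs P -> open (triv_dom P);
  triv_cover : forall x : M, exists2 P, trivs P & triv_dom P x;
  triv_linear : forall P x, trivs P -> triv_dom P x ->
    linear (triv_map P (x := x));
  triv_bij : forall P x, trivs P -> triv_dom P x ->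
    bijective (triv_map P (x := x));
  triv_smooth : forall P P', trivs P -> trivs P' ->
    exists2 T : M -> 'M[R[i]]_d,
      smooth_open (Y := euclidean (d * d + d * d)) (triv_dom P `&` triv_dom P')
        (fun x => mx_coords (T x)) &
      forall x v, triv_dom P x -> triv_dom P' x ->
        triv_map P' v = T x *m triv_map P (x := x) v }.

Arguments trivs {R M d}.

Section LinearGroupoid.
Context {R : realType} {M : chartedSpace R} {d : nat} (V : vectorBundle M d).

Record gl_arrow := GLArrow {
  gl_src : M;
  gl_tgt : M;
  gl_fun :> fiber V gl_src -> fiber V gl_tgt;
  gl_linear : linear gl_fun;
  gl_bij : bijective gl_fun }.

Lemma gl_id_bij (x : M) : bijective (@id (fiber V x)).
Proof. by exists id. Qed.

Definition gl_id (x : M) : gl_arrow :=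
  @GLArrow x x id (fun _ _ _ => erefl) (gl_id_bij x).

Lemma gl_comp_linear (x y z : M) (f : fiber V y -> fiber V z)
    (h : fiber V x -> fiber V y) :
  linear f -> linear h -> linear (f \o h).
Proof. by move=> lf lh a u v /=; rewrite lh lf. Qed.

Definition gl_comp_in (x y z : M) (f : fiber V y -> fiber V z)
    (lf : linear f) (bf : bijective f) (h : fiber V x -> fiber V y)
    (lh : linear h) (bh : bijective h) : gl_arrow :=
  @GLArrow x z (f \o h) (gl_comp_linear lf lh) (bij_comp bf bh).

Definition gl_comp (a b : gl_arrow) : gl_arrow :=
  match a, b with
  | @GLArrow y z f lf bf, @GLArrow x y' h lh bh =>
    match pselect (y' = y) with
    | left e =>
      (match e in _ = y0 return forall f0 : fiber V y0 -> fiber V z,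
           linear f0 -> bijective f0 -> gl_arrow with
       | erefl => fun f0 lf0 bf0 => gl_comp_in lf0 bf0 lh bh
       end) f lf bf
    | right _ => a
    end
  end.

Lemma bij_inv (S T : Type) (f : S -> T) :
  bijective f -> exists2 h : T -> S, cancel f h & cancel h f.
Proof. by case=> h fh hf; exists h. Qed.

Definition gl_inv_fun (a : gl_arrow) : fiber V (gl_tgt a) -> fiber V (gl_src a) :=
  s2val (cid2 (bij_inv (gl_bij a))).

Lemma gl_inv_linear (a : gl_arrow) : linear (@gl_inv_fun a).
Proof.
rewrite /gl_inv_fun; case: cid2 => /= h fh hf k u v.
by apply: (can_inj fh); rewrite hf (@gl_linear a k) !hf.
Qed.

Lemma gl_inv_bij (a : gl_arrow) : bijective (@gl_inv_fun a).
Proof. by rewrite /gl_inv_fun; case: cid2 => /= h fh hf; exists a. Qed.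

Definition gl_inv (a : gl_arrow) : gl_arrow :=
  GLArrow (gl_inv_linear (a := a)) (gl_inv_bij a).

Definition gl_dim : nat := cs_dim M + (cs_dim M + (d * d + d * d)).

(* The pair of a chart domain and a chart map on arrows: a linear isomorphism
   between the fibers over x and y is mapped to the coordinates of x, those
   of y, and its matrix in given trivializations around x and y. *)
Definition gl_is_chart (D : set gl_arrow) (psi : gl_arrow -> 'rV[R]_gl_dim) :
    Prop :=
  exists c c' P P',
  [/\ cs_atlas M c /\ cs_atlas M c', trivs V P /\ trivs V P',
      D = [set a | (chart_dom c `&` triv_dom P) (gl_src a) /\
                   (chart_dom c' `&` triv_dom P') (gl_tgt a)] &
      forall a, D a -> exists2 A : 'M[R[i]]_d,
        (forall v, triv_map P' (a v) = A *m triv_map P v) &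
        psi a = row_mx (chart_map c (gl_src a))
                  (row_mx (chart_map c' (gl_tgt a)) (mx_coords A))].

(* the topology for which the charts are homeomorphisms onto open sets *)
Definition gl_open (O : set gl_arrow) : Prop :=
  forall D psi, gl_is_chart D psi -> forall a, O a -> D a ->
    \forall w \near psi a, forall b, D b -> psi b = w -> O b.

Lemma gl_openT : gl_open setT.
Proof. by move=> D psi _ a _ _; exact: filterE. Qed.

Lemma gl_openI : setI_closed gl_open.
Proof.
move=> A B oA oB D psi cD a [Aa Ba] Da.
by apply: filterS2 (oA D psi cD a Aa Da) (oB D psi cD a Ba Da) => w hA hB b Db bw;
  split; [exact: hA|exact: hB].
Qed.

Lemma gl_open_bigU (I : Type) (f : I -> set gl_arrow) :
  (forall i, gl_open (f i)) -> gl_open (\bigcup_i f i).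
Proof.
move=> of_ D psi cD a [i _ fa] Da.
by apply: filterS (of_ i _ _ cD a fa Da) => w h b Db bw; exists i => //; exact: h.
Qed.

HB.instance Definition _ := gen_eqMixin gl_arrow.
HB.instance Definition _ := gen_choiceMixin gl_arrow.
HB.instance Definition _ :=
  isOpenTopological.Build gl_arrow gl_openT gl_openI gl_open_bigU.

Definition gl_space : chartedSpace R :=
  @ChartedSpace R gl_arrow gl_dim
    [set c | gl_is_chart (chart_dom c) (chart_map c)].

Definition GL : groupoidData R :=
  @GroupoidData R gl_space M gl_src gl_tgt gl_id gl_comp gl_inv.

End LinearGroupoid.

Definition is_representation (R : realType) (G : groupoidData R) (d : nat)
    (V : vectorBundle (ob G) d) (r : arr G -> arr (GL V)) : Prop :=
  is_lie_groupoid_hom (G := G) (H := GL V) id r.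

Definition faithfully_representable (R : realType) (G : groupoidData R) :
    Prop :=
  exists d (V : vectorBundle (ob G) d) (r : arr G -> arr (GL V)),
    is_representation r /\ injective r.

(* a group with a topology, not assumed to be compatible *)
#[short(type="groupTopologicalType")]
HB.structure Definition GroupTopological := {T of Group T & Topological T}.

Record lieGroup (R : realType) := LieGroup {
  lg_sort :> groupTopologicalType;
  lg_dim : nat;
  lg_atlas : set (chart R lg_sort lg_dim);
  lg_space := ChartedSpace lg_atlas;
  lg_manifold : smooth_manifold lg_space;
  lg_mul_smooth : smooth (X := prod_space lg_space lg_space) (Y := lg_space)
    (fun p => (p.1 * p.2)%g);
  lg_inv_smooth : smooth (X := lg_space) (Y := lg_space) (fun k => k^-1%g) }.

Section Characters.
Context {R : realType} (K : groupTopologicalType).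

Definition is_group_representation (d : nat) (A : K -> 'M[R[i]]_d) : Prop :=
  [/\ A 1%g = 1%:M, (forall k l, A (k * l)%g = A k *m A l) &
      continuous (fun k => mx_coords (A k))].

Definition faithful_character (chi : K -> R[i]) : Prop :=
  exists d (A : K -> 'M[R[i]]_d),
    [/\ is_group_representation A, injective A & chi = fun k => \tr (A k)].

Definition is_automorphism (mu : K -> K) : Prop :=
  exists nu : K -> K,
    [/\ cancel mu nu, cancel nu mu, continuous mu, continuous nu &
        {morph mu : k l / (k * l)%g}].

End Characters.

Definition path_component (R : realType) (T : topologicalType) (A : set T)
    (x : T) : set T :=
  [set y | exists gamma : R -> T,
    [/\ {within `[0, 1], continuous gamma}, gamma 0 = x, gamma 1 = y &
        forall t, `[0, 1]%classic t -> A (gamma t)]].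

Section Monodromy.
Context {R : realType} (K : groupTopologicalType) (G : groupoidData R).

Definition homs : set {compact-open, K -> arr G} :=
  [set phi | continuous (phi : K -> arr G) /\
     exists x : ob G,
     [/\ (forall k, src (phi k) = x), (forall k, tgt (phi k) = x) &
         (forall k l, phi (k * l)%g = gcomp (phi k) (phi l))]].

(* the base point omega(phi), for phi in [homs] *)
Definition base_point (phi : K -> arr G) : ob G := src (phi 1%g).

Definition conj_act (g : arr G) (phi : K -> arr G) : {compact-open, K -> arr G} :=
  fun k => gcomp (gcomp g (phi k)) (invarr g).

Definition homs_saturated (S : set {compact-open, K -> arr G}) : Prop :=
  [/\ S `<=` homs,
      (forall phi, S phi -> path_component R homs phi `<=` S) &
      (forall g phi, S phi -> src g = base_point phi -> S (conj_act g phi))].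

Definition homs_of (rho : K -> arr G) : set {compact-open, K -> arr G} :=
  smallest homs_saturated [set rho : {compact-open, K -> arr G}].

Definition Mon (rho : K -> arr G) : set (K -> K) :=
  [set mu | is_automorphism mu /\
     [set ((phi : K -> arr G) \o mu : {compact-open, K -> arr G}) |
        phi in homs_of rho] = homs_of rho].

End Monodromy.

Arguments homs {R} K G.

(* Main.v *)
Require Import Defs.
From HB Require Import structures.
From mathcomp Require Import all_boot all_order all_algebra ring.
From mathcomp Require Import all_classical all_reals all_analysis.
From mathcomp Require Import complex.
Import Order.TTheory GRing.Theory Num.Theory.
Import numFieldNormedType.Exports.
Local Open Scope classical_set_scope.
Local Open Scope ring_scope.

(** The character is [chi k = tr (r (rho k))], where [r] is a faithful
    representation of the groupoid.  Any [phi] in [homs K G] has a character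
    [k |-> tr (r (phi k))] in the same way, which conjugation by an arrow
    preserves.  Along a path of homomorphisms the character varies continuously
    for the uniform norm, as [K] is compact; but two characters of [K] at uniform
    distance at most 1/2 are equal.  Indeed, at the powers of one element [k]
    they are sums of n-th powers of complex numbers of modulus 1, and the
    multiplicity of [z] in such a sum is the limit of the averages of its
    product with [z^-n], so that the two integer multiplicities differ by at
    most 1/2.  Hence all of [homs_of rho] has character [chi]; in particular so
    does [rho \o mu], whose character is [chi \o mu]. *)

(** * Power sums of numbers of modulus 1 *)

Lemma bernoulli_le (C : numDomainType) (y : C) (n : nat) :
  0 <= y -> 1 + y *+ n <= (1 + y) ^+ n.
Proof.
move=> y0; elim: n => [|n IH]; first by rewrite mulr0n addr0 expr0.
rewrite exprS mulrDl mul1r mulrSr addrA lerD //.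
apply: le_trans (ler_wpM2l y0 IH).
by rewrite mulrDr mulr1 lerDl mulr_ge0 // mulrn_wge0.
Qed.

Section Archimedean.
Variable C : numClosedFieldType.
Hypothesis archi : forall x : C, exists n : nat, `|x| <= n%:R.

(** If [|x| = 1 + y] with [y > 0], Bernoulli's inequality makes [|x| ^+ n] at least [1 + n y], which
    exceeds [M] for large [n] by [archi]. *)
Lemma normr_le1_of_bounded (x M : C) : (forall n, `|x ^+ n| <= M) -> `|x| <= 1.
Proof.
move=> xM; have [//|x_gt1] := real_leP (normr_real x) (real1 C).
have y_gt0 : 0 < `|x| - 1 by rewrite subr_gt0.
have [n Mn] := archi (M / (`|x| - 1)).
have /(le_trans (bernoulli_le _ _ n (ltW y_gt0))) : (1 + (`|x| - 1)) ^+ n <= M.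
  by rewrite addrC subrK -normrX.
have M_ge0 : 0 <= M by apply: le_trans (xM 0%N).
move: Mn; rewrite ger0_norm ?divr_ge0 ?(ltW y_gt0) // ler_pdivrMr // mulr_natl.
move=> Mn /le_trans /(_ Mn); rewrite gerDr => /(lt_le_trans ltr01).
by rewrite ltxx.
Qed.

(** The geometric sum times [w - 1] is [w ^+ N - 1], of norm at most 2. *)
Lemma sum_power_bounded (w : C) : `|w| = 1 -> w != 1 ->
  exists M : C, forall N, `|\sum_(n < N) w ^+ n| <= M.
Proof.
move=> w1 wn1; exists (2 / `|w - 1|) => N.
have w0 : 0 < `|w - 1| by rewrite normr_gt0 subr_eq0.
rewrite ler_pdivlMr // mulrC -normrM -subrX1.
by rewrite (le_trans (ler_normB _ _)) // normrX w1 expr1n normr1.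
Qed.

(** Each entry of [s] equal to [z] contributes exactly [N], and any other one a geometric sum that
    stays bounded in [N]. *)
Lemma power_sum_mean (s : seq C) (z : C) : `|z| = 1 ->
  {in s, forall x, `|x| = 1} ->
  exists M : C, forall N,
  `|\sum_(n < N) \sum_(x <- s) (x / z) ^+ n - (count_mem z s * N)%:R| <= M.
Proof.
move=> z1; have z0 : z != 0 by rewrite -normr_eq0 z1 oner_eq0.
elim: s => [_|x s IH s1].
  by exists 0 => N; rewrite big1 ?subr0 ?normr0 // => i _; rewrite big_nil.
have [M HM] := IH (fun y ys => s1 y (mem_behead (s := x :: s) ys)).
have [M' HM'] : exists M' : C, forall N,
    `|\sum_(n < N) (x / z) ^+ n - ((x == z) * N)%:R| <= M'.
  have [->|xz] := eqVneq x z.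
    exists 0 => N; rewrite divff // mul1n.
    under eq_bigr do rewrite expr1n.
    by rewrite sumr_const card_ord subrr normr0.
  have [||M' HM'] := @sum_power_bounded (x / z).
  - by rewrite normrM normfV z1 invr1 mulr1 s1 // mem_head.
  - by rewrite -subr_eq0 -(divff z0) -mulrBl mulf_neq0 ?invr_eq0 // subr_eq0.
  by exists M' => N; rewrite mul0n subr0.
exists (M' + M) => N; apply: le_trans (lerD (HM' N) (HM N)).
apply: le_trans (ler_normD _ _); rewrite le_eqVlt; apply/orP; left; apply/eqP.
congr (`|_|); under eq_bigr do rewrite big_cons.
by rewrite big_split /= mulnDl natrD opprD addrACA.
Qed.

(** If the multiplicities [a] and [b] of some [z] differ, then [n <= |a n - b n| <= n / 2 + M + M']
    for all [n], by closeness and [power_sum_mean]. *)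
Lemma perm_eq_of_close_power_sums (s t : seq C) :
  {in s, forall x, `|x| = 1} -> {in t, forall x, `|x| = 1} ->
  (forall n, `|\sum_(x <- s) x ^+ n - \sum_(x <- t) x ^+ n| <= 2^-1) ->
  perm_eq s t.
Proof.
move=> s1 t1 st; rewrite /perm_eq; apply/allP => z; rewrite mem_cat => zst.
have z1 : `|z| = 1 by case/orP: zst => [/s1|/t1].
have [M HM] := @power_sum_mean s z z1 s1.
have [M' HM'] := @power_sum_mean t z z1 t1.
set a := count_mem z s in HM *; set b := count_mem z t in HM' *.
apply: contraT => ab.
have ab1 : 1 <= `|a%:R - b%:R : C|.
  have -> : a%:R - b%:R = (a%:Z - b%:Z)%:~R :> C by rewrite rmorphB.
  by rewrite -intr_norm ler1z -gtz0_ge1 normr_gt0 subr_eq0 eqz_nat.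
(* The extra 1 makes [n] exceed [2 (M + M')], against the inequality obtained next. *)
have [n Hn] := archi ((M + M' + 1) *+ 2).
have : n%:R <= n%:R / 2 + (M + M').
  have h1 : n%:R <= `|(a * n)%:R - (b * n)%:R : C|.
    by rewrite !natrM -mulrBl normrM normr_nat ler_peMl ?ler0n.
  apply: le_trans h1 _.
  have := HM n.
  set S := (X in `|X - _| <= M) => hS.
  have := HM' n; set S' := (X in `|X - _| <= M') => hS'.
  have -> : (a * n)%:R - (b * n)%:R = (S - S') - (S - (a * n)%:R) + (S' - (b * n)%:R).
    by ring.
  apply: le_trans (ler_normD _ _) _; rewrite addrA lerD //.
  apply: le_trans (ler_normB _ _) _; rewrite lerD //.
  rewrite /S /S' -sumrB; apply: le_trans (ler_norm_sum _ _ _) _.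
  have -> : n%:R / 2 = \sum_(i < n) 2^-1 :> C.
    by rewrite sumr_const card_ord mulr_natl.
  apply: ler_sum => i _.
  have -> : \sum_(x <- s) (x / z) ^+ i - \sum_(x <- t) (x / z) ^+ i =
      (\sum_(x <- s) x ^+ i - \sum_(x <- t) x ^+ i) * z^-1 ^+ i.
    by rewrite mulrBl !mulr_suml; congr (_ - _); apply: eq_bigr => x _; rewrite exprMn.
  by rewrite normrM normrX normfV z1 invr1 expr1n mulr1.
rewrite -lerBlDl {1}[n%:R]splitr addrK ler_pdivrMr // mulr_natr => h.
have MM : 0 <= M + M'.
  by rewrite addr_ge0 //; [apply: le_trans (HM 0%N)|apply: le_trans (HM' 0%N)].
have := le_trans Hn h; rewrite ger0_norm ?mulrn_wge0 ?(addr_ge0 MM ler01) //.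
by rewrite lerMn2r /= gerDl ler10.
Qed.

(** * Eigenvalues and traces of powers of a matrix *)

Lemma is_trig_exp_diag (n : nat) (A : 'M[C]_n) (m : nat) : is_trig_mx A ->
  is_trig_mx (A ^+ m) /\ forall i, (A ^+ m) i i = A i i ^+ m.
Proof.
move=> /is_trig_mxP tA; elim: m => [|m [/is_trig_mxP tm dm]].
  by split=> [|i]; rewrite ?scalar_mx_is_trig // mxE eqxx.
split=> [|i].
  apply/is_trig_mxP => i j ij; rewrite exprS mxE big1 // => k _.
  have [ik|ki] := ltnP i k; first by rewrite tA ?mul0r.
  by rewrite tm ?mulr0 // (leq_ltn_trans ki).
rewrite exprS mxE (bigD1 i) //= dm -exprS big1 ?addr0 // => k ki.
have [ik|ik] := ltnP i k; first by rewrite tA ?mul0r.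
by rewrite tm ?mulr0 // ltn_neqAle ik andbT.
Qed.

(** Schur's theorem conjugates [A] to a triangular [T]; the diagonal of [T] consists of eigenvalues
    of [A], and that of [T ^+ m] of their powers. *)
Lemma mxtrace_exp_eigenvalues (n : nat) (A : 'M[C]_n) :
  exists2 s : seq C, {in s, forall x, eigenvalue A x} &
    forall m, \tr (A ^+ m) = \sum_(x <- s) x ^+ m.
Proof.
case: n A => [|n] A.
  by exists [::] => // m; rewrite /mxtrace big_ord0 big_nil.
have [P /unitarymx_unit Pu trigT] := Schur A (ltn0Sn n).
have Pf : row_free P by rewrite row_free_unit.
have Ps : stablemx P A by rewrite submx_full // row_full_unit.
set T := conjmx P A in trigT.
have TE : T = P *m A *m invmx P by rewrite /T conjumx.
exists [seq T i i | i : 'I_n.+1] => [x /mapP[i _ ->]|m].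
  apply: (eigenvalue_conjmx Ps Pf); rewrite -topredE /= eigenvalue_root_char.
  by rewrite char_poly_trig // /root horner_prod (bigD1 i) //= hornerXsubC subrr mul0r.
have TmE : T ^+ m = P *m A ^+ m *m invmx P.
  elim: m => [|m IH]; first by rewrite !expr0 mulmx1 mulmxV.
  rewrite !exprS IH TE -![_ * _]/(_ *m _) !mulmxA.
  by rewrite -[_ *m invmx P *m P]mulmxA mulVmx // mulmx1.
rewrite big_map big_enum /=; have [_ diagT] := is_trig_exp_diag _ _ m trigT.
rewrite -(eq_bigr _ (fun i _ => diagT i)) -/(\tr (T ^+ m)) TmE.
by rewrite mxtrace_mulC mulmxA mulVmx // mul1mx.
Qed.

(** A left eigenvector [v] satisfies [v *m A ^+ m = x ^+ m *: v], so a nonzero coordinate of [v]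
    yields a bound on all powers of [x]. *)
Lemma eigenvalue_norm_le1 (n : nat) (A : 'M[C]_n) (x : C) :
  (exists M, forall m i j, `|(A ^+ m) i j| <= M) -> eigenvalue A x -> `|x| <= 1.
Proof.
move=> [M AM] /eigenvalueP[v vA v0].
have vAm m : v *m A ^+ m = x ^+ m *: v.
  elim: m => [|m IH]; first by rewrite !expr0 mulmx1 scale1r.
  by rewrite exprS mulmxA vA -scalemxAl IH scalerA -exprS.
have [i vi] : exists i, v 0 i != 0.
  apply/existsP; apply: contra_neqT v0 => /existsPn v0.
  by apply/rowP => i; rewrite mxE; apply/eqP; rewrite -[_ == _]negbK v0.
apply: (@normr_le1_of_bounded x ((\sum_j `|v 0 j| * M) / `|v 0 i|)) => m.
rewrite ler_pdivlMr ?normr_gt0 // -normrM.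
have -> : x ^+ m * v 0 i = (v *m A ^+ m) 0 i by rewrite vAm mxE.
rewrite mxE (le_trans (ler_norm_sum _ _ _)) // ler_sum // => j _.
by rewrite normrM ler_wpM2l.
Qed.

(** The inverse [B] has the eigenvalue [x^-1], which gives the opposite inequality. *)
Lemma eigenvalue_norm1 (n : nat) (A B : 'M[C]_n) (x : C) : A *m B = 1%:M ->
  (exists M, forall m i j, `|(A ^+ m) i j| <= M) ->
  (exists M, forall m i j, `|(B ^+ m) i j| <= M) ->
  eigenvalue A x -> `|x| = 1.
Proof.
move=> AB bA bB eAx; apply/eqP; rewrite eq_le (eigenvalue_norm_le1 _ _ _ bA eAx).
have /eigenvalueP[v vA v0] := eAx.
have vE : v = x *: (v *m B) by rewrite scalemxAl -vA -mulmxA AB mulmx1.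
have x0 : x != 0 by apply: contra_neq v0 => x0; rewrite vE x0 scale0r.
have eBx : eigenvalue B x^-1.
  by apply/eigenvalueP; exists v; rewrite // {2}vE scalerA mulVf // scale1r.
have := eigenvalue_norm_le1 _ _ _ bB eBx.
by rewrite normfV invf_le1 // normr_gt0.
Qed.

(** The eigenvalues have modulus 1 by boundedness, and traces of powers are their power sums;
    closeness thus forces equal eigenvalues with multiplicities. *)
Lemma mxtrace_eq_of_close_powers (n : nat) (A A' B B' : 'M[C]_n) :
  A *m A' = 1%:M -> B *m B' = 1%:M ->
  {in [:: A; A'; B; B'], forall D : 'M[C]_n,
     exists M, forall m i j, `|(D ^+ m) i j| <= M} ->
  (forall m, `|\tr (A ^+ m) - \tr (B ^+ m)| <= 2^-1) -> \tr A = \tr B.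
Proof.
move=> AA BB bnd.
have [s sA trA] := mxtrace_exp_eigenvalues _ A.
have [t tB trB] := mxtrace_exp_eigenvalues _ B.
move=> close; rewrite -[A]expr1 -[B]expr1 trA trB; apply: perm_big => /=.
apply: perm_eq_of_close_power_sums => [x /sA|x /tB|m].
- by apply: (eigenvalue_norm1 _ _ _ _ AA); apply: bnd; rewrite !inE eqxx ?orbT.
- by apply: (eigenvalue_norm1 _ _ _ _ BB); apply: bnd; rewrite !inE eqxx ?orbT.
by rewrite -trA -trB.
Qed.
End Archimedean.

(** * Convergence of complex matrices through real coordinates *)

Lemma cvg_rV (R : realType) (T : Type) (n : nat) (F : set_system T)
    (FF : Filter F) (f : T -> 'rV[R]_n) (v : 'rV[R]_n) :
  f @ F --> v <-> forall j, (fun t => f t 0 j) @ F --> v 0 j.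
Proof.
split=> [fv j|fv].
  move=> A vA; apply: (fv [set M : 'rV[R]_n | A (M 0 j)]).
  exact: (coord_continuous vA).
move=> A [P vP PA]; rewrite nbhs_simpl.
apply: (@filterS _ F _ [set t | forall j, P 0 j (f t 0 j)]).
  by move=> t Pt; apply: PA => i j; rewrite (ord1 i).
by apply: filter_forall => j; apply: fv.
Qed.

Lemma normc_ge_Im (R : rcfType) (z : R[i]) : `|complex.Im z|%:C%C <= `|z|.
Proof. by rewrite normc_def lecR -sqrtr_sqr ler_wsqrtr // lerDr sqr_ge0. Qed.

Lemma normc_le_ReIm (R : rcfType) (z : R[i]) :
  `|z| <= (`|complex.Re z| + `|complex.Im z|)%:C%C.
Proof.
rewrite normc_def lecR -(ger0_norm (addr_ge0 (normr_ge0 _) (normr_ge0 _))).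
rewrite -sqrtr_sqr ler_wsqrtr // sqrrD !real_normK ?num_real // addrAC.
by rewrite lerDl mulrn_wge0 // mulr_ge0.
Qed.

Lemma complex_ReB (R : rcfType) (x y : R[i]) :
  complex.Re (x - y) = complex.Re x - complex.Re y.
Proof. by case: x y => [? ?] [? ?]. Qed.

Lemma complex_ImB (R : rcfType) (x y : R[i]) :
  complex.Im (x - y) = complex.Im x - complex.Im y.
Proof. by case: x y => [? ?] [? ?]. Qed.

(* A structure-typed name for [R[i]], for its norm topology to be inferred. *)
Definition complexField (R : realType) : numFieldType := R[i].

Lemma cvg_complexP (R : realType) (T : Type) (F : set_system T)
    (FF : Filter F) (f : T -> complexField R) (z : complexField R) :
  f @ F --> z <-> (fun t => complex.Re (f t)) @ F --> complex.Re z /\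
                  (fun t => complex.Im (f t)) @ F --> complex.Im z.
Proof.
split=> [fz|[fr fi]].
  split; apply/cvgrPdist_lt => e e0; move/cvgrPdist_lt: fz => /(_ e%:C%C);
    rewrite ltcR => /(_ e0); apply: filterS => t /=.
    by rewrite -complex_ReB -ltcR; apply: le_lt_trans; apply: normc_ge_Re.
  by rewrite -complex_ImB -ltcR; apply: le_lt_trans; apply: normc_ge_Im.
(* The radius [c] is itself complex; its positivity means that it is real and positive. *)
apply/cvgrPdist_lt => c; move: (c : R[i]) => {c}[e e']; rewrite ltcE /= => /andP[/eqP -> e0].
have e20 : 0 < e / 2 by rewrite divr_gt0.
move/cvgrPdist_lt: fr => /(_ _ e20) fr; move/cvgrPdist_lt: fi => /(_ _ e20) fi.
apply: filterS2 fr fi => t /=; rewrite -complex_ReB -complex_ImB => hr hi.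
by rewrite (le_lt_trans (normc_le_ReIm _ _)) // ltcR [e]splitr ltrD.
Qed.

Lemma cvg_mx_coords (R : realType) (T : Type) (d : nat) (F : set_system T)
    (FF : Filter F) (f : T -> 'M[R[i]]_d) (A : 'M[R[i]]_d) :
  (fun t => mx_coords (f t)) @ F --> mx_coords A <->
  forall i j, (fun t => f t i j : complexField R) @ F -->
    (A i j : complexField R).
Proof.
rewrite cvg_rV; split=> [h i j|h k].
  apply/cvg_complexP; split.
    have := h (lshift _ (mxvec_index i j)).
    rewrite /mx_coords row_mxEl mxvecE mxE.
    by under eq_fun do rewrite row_mxEl mxvecE mxE.
  have := h (rshift _ (mxvec_index i j)).
  rewrite /mx_coords row_mxEr mxvecE mxE.
  by under eq_fun do rewrite row_mxEr mxvecE mxE.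
rewrite /mx_coords; case: (split_ordP k) => l ->.
  rewrite row_mxEl; under eq_fun do rewrite row_mxEl.
  case/mxvec_indexP: l => i j; rewrite mxvecE mxE.
  under eq_fun do rewrite mxvecE mxE.
  by have /cvg_complexP[] := h i j.
rewrite row_mxEr; under eq_fun do rewrite row_mxEr.
case/mxvec_indexP: l => i j; rewrite mxvecE mxE.
under eq_fun do rewrite mxvecE mxE.
by have /cvg_complexP[] := h i j.
Qed.

Lemma cvg_bigsum (K : numFieldType) (T : Type) (I : finType)
    (F : set_system T) (FF : Filter F) (f : I -> T -> K) (a : I -> K) :
  (forall i, f i @ F --> a i) ->
  (fun t => \sum_i f i t) @ F --> \sum_i a i.
Proof.
move=> fa; elim: (index_enum I) => [|i r IH].
  under eq_fun do rewrite big_nil; rewrite big_nil; exact: cvg_cst.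
under eq_fun do rewrite big_cons; rewrite big_cons; exact: cvgD.
Qed.

Lemma cvg_mx_coords_mul (R : realType) (T : Type) (d : nat) (F : set_system T)
    (FF : Filter F) (f g : T -> 'M[R[i]]_d) (A B : 'M[R[i]]_d) :
  (fun t => mx_coords (f t)) @ F --> mx_coords A ->
  (fun t => mx_coords (g t)) @ F --> mx_coords B ->
  (fun t => mx_coords (f t *m g t)) @ F --> mx_coords (A *m B).
Proof.
move=> /cvg_mx_coords fA /cvg_mx_coords gB; apply/cvg_mx_coords => i j.
rewrite mxE; under eq_fun do rewrite mxE.
have cvg_mul k : (fun t => f t i k * g t k j : complexField R) @ F -->
    (A i k * B k j : complexField R).
  exact: (cvgM (fA i k) (gB k j)).
exact: cvg_bigsum.
Qed.

Lemma cvg_mxtrace (R : realType) (T : Type) (d : nat) (F : set_system T)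
    (FF : Filter F) (f : T -> 'M[R[i]]_d) (A : 'M[R[i]]_d) :
  (fun t => mx_coords (f t)) @ F --> mx_coords A ->
  (fun t => \tr (f t) : complexField R) @ F --> (\tr A : complexField R).
Proof. by move=> /cvg_mx_coords fA; apply: cvg_bigsum => i; apply: fA. Qed.

(** * Characters of a compact group *)

Lemma complex_archi (R : realType) (z : R[i]) : exists n : nat, `|z| <= n%:R.
Proof.
exists (Num.truncn (`|complex.Re z| + `|complex.Im z|)).+1.
rewrite (le_trans (normc_le_ReIm _ z)) // -(rmorph_nat (real_complex R)).
by rewrite lecR ltW // truncnS_gt.
Qed.

Lemma mx_entries_bounded (R : realType) (K : topologicalType) (d : nat)
    (A : K -> 'M[R[i]]_d) :
  compact [set: K] -> continuous (fun k => mx_coords (A k)) ->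
  exists M : R[i], forall k i j, `|A k i j| <= M.
Proof.
move=> cK cA.
have /compact_bounded [M [_ /(_ (M + 1))]] :
    compact ((fun k => mx_coords (A k)) @` [set: K]).
  by apply: continuous_compact => //; apply: continuous_subspaceT.
rewrite ltrDl ltr01 => /(_ erefl) AM.
(* Boundedness gives a bound for each constant above [M]; [M + 1] then bounds the real and imaginary
   parts separately, whence the factor 2. *)
exists ((M + 1) *+ 2)%:C%C => k i j.
have Ak l : `|mx_coords (A k) 0 l| <= M + 1.
  apply: le_trans (AM (mx_coords (A k)) _); last by exists k.
  by rewrite /Num.norm /= mx_normrE; apply: (le_bigmax _ _ (0, l)).
rewrite (le_trans (normc_le_ReIm _ _)) // lecR mulr2n lerD //.
  have := Ak (lshift _ (mxvec_index i j)).
  by rewrite /mx_coords row_mxEl mxvecE mxE.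
have := Ak (rshift _ (mxvec_index i j)).
by rewrite /mx_coords row_mxEr mxvecE mxE.
Qed.

(** Powers of [A k] are values of [A] at powers of [k]: compactness bounds them, and the hypothesis
    at these powers compares their traces. *)
Lemma character_eq_of_close (R : realType) (K : groupTopologicalType) (d : nat)
    (A B : K -> 'M[R[i]]_d) :
  compact [set: K] -> is_group_representation A -> is_group_representation B ->
  (forall k, `|\tr (A k) - \tr (B k)| <= 2^-1) ->
  forall k, \tr (A k) = \tr (B k).
Proof.
move=> cK rA rB AB k.
have powE (D : K -> 'M[R[i]]_d) (rD : is_group_representation D) l m :
    D l ^+ m = D (l ^+ m)%g.
  have [D1 DM _] := rD; elim: m => [|m IH]; first by rewrite expr0 expg0 D1.
  by rewrite exprS IH expgS DM.
have bnd (D : K -> 'M[R[i]]_d) (rD : is_group_representation D) l :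
    exists M, forall m i j, `|(D l ^+ m) i j| <= M.
  have [_ _ cD] := rD; have [M DM] := mx_entries_bounded _ _ _ _ cK cD.
  by exists M => m i j; rewrite powE.
have inv (D : K -> 'M[R[i]]_d) (rD : is_group_representation D) l :
    D l *m D (l^-1)%g = 1%:M.
  by have [D1 DM _] := rD; rewrite -DM mulgV.
apply: (mxtrace_eq_of_close_powers _ (@complex_archi R) _ _ _ _ _
  (inv _ rA k) (inv _ rB k)).
  by move=> D; rewrite !inE => /or4P[] /eqP ->; apply: bnd.
by move=> m; rewrite !powE.
Qed.

(** * Matrices of arrows of [GL V] in trivializations *)

Lemma chart_cvg (R : realType) (X : topologicalType) (n : nat)
    (c : chart R X n) (T : Type) (F : set_system T) (FF : Filter F)
    (f : T -> X) (x : X) :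
  is_chart c -> chart_dom c x -> (\forall t \near F, chart_dom c (f t)) ->
  (fun t => chart_map c (f t)) @ F --> chart_map c x -> f @ F --> x.
Proof.
move=> [oc injc _ openc] cx cf fx N; rewrite nbhsE => -[B [oB Bx] BN].
have oOc : open (chart_map c @` (B `&` chart_dom c)).
  by apply: openc; [apply: openI|move=> ? []].
have /fx Fc : nbhs (chart_map c x) (chart_map c @` (B `&` chart_dom c)).
  apply: open_nbhs_nbhs; split => //; exists x => //.
apply: filterS2 cf Fc => t ct [y [By cy] yt]; apply: BN.
by rewrite /= -(injc y (f t)) ?inE.
Qed.

Lemma linear_cV_mx (C : comPzRingType) (n m : nat) (f : 'cV[C]_n -> 'cV[C]_m) :
  linear f -> exists A : 'M[C]_(m, n), forall u, f u = A *m u.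
Proof.
move=> lf; pose g : {linear 'cV[C]_n -> 'cV[C]_m} :=
  HB.pack f (GRing.isLinear.Build _ _ _ _ f lf).
exists (\matrix_(i, j) f (delta_mx j 0) i 0) => u.
have -> : f u = g u by [].
rewrite {1}[u]matrix_sum_delta raddf_sum /=.
apply/colP => i; rewrite summxE mxE; apply: eq_bigr => j _.
have fZ : f (u j ord0 *: delta_mx j ord0) = u j 0 *: f (delta_mx j 0).
  exact: (linearZZ g).
by rewrite big_ord1 fZ !mxE mulrC.
Qed.

Lemma cvg_row_mx (R : realType) (T : Type) (m n : nat) (F : set_system T)
    (FF : Filter F) (f : T -> 'rV[R]_m) (g : T -> 'rV[R]_n) (u : 'rV[R]_m) (v : 'rV[R]_n) :
  (fun t => row_mx (f t) (g t)) @ F --> row_mx u v -> f @ F --> u /\ g @ F --> v.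
Proof.
move=> /cvg_rV fg; split; apply/cvg_rV => j.
  by have := fg (lshift n j); rewrite row_mxEl; under eq_fun do rewrite row_mxEl.
by have := fg (rshift m j); rewrite row_mxEr; under eq_fun do rewrite row_mxEr.
Qed.

Section ArrowMatrix.
Context {R : realType} {M : chartedSpace R} {d : nat} {V : vectorBundle M d}.
Implicit Types (P Q : trivialization (fiber V) d) (a b : gl_arrow V).

(** A relation and not a function, because [triv_map] is arbitrary off its domain, where such a
    matrix may fail to exist or to be unique. *)
Definition arr_mx P Q a (A : 'M[R[i]]_d) : Prop :=
  forall v, triv_map Q (a v) = A *m triv_map P v.

Lemma arr_mx_exists P Q a : trivs V P -> trivs V Q ->
  triv_dom P (gl_src a) -> triv_dom Q (gl_tgt a) -> exists A, arr_mx P Q a A.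
Proof.
move=> tP tQ Pa Qa; have [p Pp pP] := triv_bij tP Pa.
have lp : linear p.
  move=> k u v; apply: (can_inj Pp); rewrite pP (triv_linear tP Pa) !pP; exact: erefl.
have [A fA] : exists A : 'M[R[i]]_d, forall u, triv_map Q (a (p u)) = A *m u.
  apply: (linear_cV_mx _ _ _ (fun u => triv_map Q (a (p u)))); move=> k u v.
  by rewrite lp (gl_linear (g := a)) (triv_linear tQ Qa).
by exists A => v; rewrite -{1}(Pp v) fA.
Qed.

Lemma arr_mx_inj P Q a A B : trivs V P -> triv_dom P (gl_src a) ->
  arr_mx P Q a A -> arr_mx P Q a B -> A = B.
Proof.
move=> tP Pa aA aB; have [p Pp pP] := triv_bij tP Pa.
apply/eqP; rewrite -subr_eq0; apply/eqP/trmx_inj/row_matrixP => i.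
rewrite trmx0 row0; apply: trmx_inj.
rewrite tr_row trmxK trmx0 colE mulmxBl -[delta_mx _ _]pP -aA -aB subrr //.
Qed.

Lemma arr_mx_comp P Q S a b A B : gl_src a = gl_tgt b ->
  arr_mx Q S a A -> arr_mx P Q b B -> arr_mx P S (gl_comp a b) (A *m B).
Proof.
case: a b => [y z f lf bf] [x y' h lh bh] /= e; case: y' / e h lh bh => h lh bh.
rewrite /arr_mx /=; case: pselect => // e aA bB.
(* [gl_comp] transports along the equality found by [pselect]; proof irrelevance turns this into the
   trivial transport. *)
rewrite (Prop_irrelevance e erefl) /= => v.
by rewrite aA bB mulmxA.
Qed.

Lemma arr_mx_id P x : arr_mx P P (gl_id V x) 1%:M.
Proof. by move=> v; rewrite mul1mx. Qed.

Hypothesis M_space : cinfty_space M.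

(** Openness is tested in charts built from arbitrary trivializations [S] and [S']. The matrix for
    [P] and [Q] is the one in the chart, multiplied on both sides by transition matrices that depend
    continuously on the endpoints. *)
Lemma arr_mx_open P Q (W : set 'rV[R]_(d * d + d * d)) :
  trivs V P -> trivs V Q -> open W ->
  open ([set a | [/\ triv_dom P (gl_src a), triv_dom Q (gl_tgt a) &
         exists2 A, arr_mx P Q a A & W (mx_coords A)]] : set (gl_space V)).
Proof.
move=> tP tQ oW; rewrite /open /=.
move=> D psi [c [c' [S [S' [[cc cc'] [tS tS'] DE psiE]]]]] a [Pa Qa [A aA WA]] Da.
(* Convergence along [F] is convergence of the coordinates to [psi a]. *)
pose F : set_system (gl_arrow V) :=
  [set Z | \forall w \near psi a, forall b, D b -> psi b = w -> Z b].
have FE Z : F Z = \forall w \near psi a, forall b, D b -> psi b = w -> Z b by [].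
have FF : Filter F.
  split=> [|Z Z'|Z Z' ZZ']; rewrite !FE.
  - exact: filterE.
  - by apply: filterS2 => w h h' b Db bw; split; [apply: h|apply: h'].
  - by apply: filterS => w h b Db bw; apply: ZZ'; apply: h.
have DF : F D by rewrite FE; apply: filterE.
(* On [D] this is the matrix recorded by [psi]; the value 0 is a default where no matrix exists. *)
pose f b := xget 0 [set B | arr_mx S S' b B].
have fP b : D b -> arr_mx S S' b (f b) /\ psi b =
    row_mx (chart_map c (gl_src b))
      (row_mx (chart_map c' (gl_tgt b)) (mx_coords (f b))).
  move=> Db; have [B bB psib] := psiE _ Db.
  have bf : arr_mx S S' b (f b) by apply: (@xgetPex _ 0 [set B | arr_mx S S' b B]); exists B.
  move: (Db); rewrite DE => -[[_ Sb] _].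
  by rewrite (arr_mx_inj _ _ _ _ _ tS Sb bf bB).
have [sF tF fF] : [/\ (fun b => chart_map c (gl_src b)) @ F --> chart_map c (gl_src a),
    (fun b => chart_map c' (gl_tgt b)) @ F --> chart_map c' (gl_tgt a) &
    (fun b => mx_coords (f b)) @ F --> mx_coords (f a)].
  have : (fun b => row_mx (chart_map c (gl_src b))
      (row_mx (chart_map c' (gl_tgt b)) (mx_coords (f b)))) @ F -->
      row_mx (chart_map c (gl_src a))
      (row_mx (chart_map c' (gl_tgt a)) (mx_coords (f a))).
    rewrite -(fP _ Da).2 => N psiN.
    have FN : F (psi @^-1` N).
      by rewrite FE; apply: filterS psiN => w Nw b _ bw; rewrite /= bw.
    by apply: filterS2 DF FN => b Db /=; rewrite (fP _ Db).2.
  by move=> /cvg_row_mx[? /cvg_row_mx[? ?]].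
have [chartM _ _] := M_space.
move: (Da); rewrite {1}DE => -[[ca Sa] [ca' Sa']].
have {}sF : (fun b => gl_src b) @ F --> gl_src a.
  apply: (@chart_cvg _ _ _ _ _ F FF _ _ (chartM _ cc) ca) sF.
  by apply: filterS DF => b; rewrite {1}DE => -[[? ?] [? ?]].
have {}tF : (fun b => gl_tgt b) @ F --> gl_tgt a.
  apply: (@chart_cvg _ _ _ _ _ F FF _ _ (chartM _ cc') ca') tF.
  by apply: filterS DF => b; rewrite {1}DE => -[[? ?] [? ?]].
have [T1 [/(_ _ (conj Pa Sa)) cT1 _] T1E] := triv_smooth tP tS.
have [T2 [/(_ _ (conj Sa' Qa)) cT2 _] T2E] := triv_smooth tS' tQ.
have hmx b : D b -> triv_dom P (gl_src b) -> triv_dom Q (gl_tgt b) ->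
    arr_mx P Q b (T2 (gl_tgt b) *m f b *m T1 (gl_src b)).
  move=> Db Pb Qb v; have [bf _] := fP _ Db.
  move: (Db); rewrite DE => -[[cb Sb] [cb' Sb']].
  by rewrite T2E // bf T1E // !mulmxA.
have cmx : (fun b => mx_coords (T2 (gl_tgt b) *m f b *m T1 (gl_src b))) @ F -->
    mx_coords A.
  rewrite -(arr_mx_inj _ _ _ _ _ tP Pa (hmx _ Da Pa Qa) aA).
  apply: cvg_mx_coords_mul; last by move=> N /cT1; apply: sF.
  by apply: cvg_mx_coords_mul => //; by move=> N /cT2; apply: tF.
have FP : F [set b | triv_dom P (gl_src b)].
  by apply: sF; apply: open_nbhs_nbhs; split => //; apply: triv_open tP.
have FQ : F [set b | triv_dom Q (gl_tgt b)].
  by apply: tF; apply: open_nbhs_nbhs; split => //; apply: triv_open tQ.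
have FW := cmx _ (open_nbhs_nbhs (conj oW WA)).
change (F [set a | [/\ triv_dom P (gl_src a), triv_dom Q (gl_tgt a) &
         exists2 A, arr_mx P Q a A & W (mx_coords A)]]).
apply: filterS3 (filterI DF FP) FQ FW => b [Db Pb] Qb Wb; split => //.
by exists (T2 (gl_tgt b) *m f b *m T1 (gl_src b)) => //; apply: hmx.
Qed.
End ArrowMatrix.

Definition mx_of_coords (R : realType) (d : nat) (w : 'rV[R]_(d * d + d * d)) :
    'M[R[i]]_d :=
  \matrix_(i, j) (w 0 (lshift _ (mxvec_index i j)) +i*
                  w 0 (rshift _ (mxvec_index i j)))%C.

Lemma mx_coordsK (R : realType) (d : nat) :
  cancel (@mx_coords R d) (@mx_of_coords R d).
Proof.
move=> A; apply/matrixP => i j.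
rewrite mxE /mx_coords row_mxEl row_mxEr !mxvecE !mxE.
by case: (A i j).
Qed.

Lemma mx_of_coordsK (R : realType) (d : nat) :
  cancel (@mx_of_coords R d) (@mx_coords R d).
Proof.
move=> w; apply/rowP => k; rewrite /mx_coords.
case: (split_ordP k) => l ->; rewrite ?row_mxEl ?row_mxEr;
  by case/mxvec_indexP: l => i j; rewrite mxvecE !mxE.
Qed.

(** Stated on coordinate vectors, to serve as the set [W] of [arr_mx_open]. *)
Lemma open_mxtrace_ball (R : realType) (d : nat) (z e : complexField R) :
  open [set w : 'rV[R]_(d * d + d * d) | `|z - \tr (mx_of_coords R d w)| < e].
Proof.
have trc : continuous (fun w : 'rV[R]_(d * d + d * d) =>
    \tr (mx_of_coords R d w) : complexField R).
  move=> w; apply: (@cvg_mxtrace _ _ _ (nbhs w) _ (mx_of_coords R d)).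
  by rewrite mx_of_coordsK => N; apply: filterS => u; rewrite /= mx_of_coordsK.
have := @open_comp _ _ (fun w : 'rV[R]_(d * d + d * d) =>
    \tr (mx_of_coords R d w) : complexField R) (ball z e).
rewrite -ball_normE; apply; first by move=> w _; apply: trc.
by rewrite ball_normE; apply: ball_open.
Qed.

Section ArrowMatrixEq.
Context {R : realType} {M : chartedSpace R} {d : nat} {V : vectorBundle M d}.
Implicit Types (P Q : trivialization (fiber V) d) (a b : gl_arrow V).

(** Injectivity of [Q] on the target fiber recovers the map from its matrix. This carries
    faithfulness from arrows over to matrices. *)
Lemma arr_mx_eq P Q a b A : trivs V Q -> triv_dom Q (gl_tgt a) ->
  gl_src a = gl_src b -> gl_tgt a = gl_tgt b ->
  arr_mx P Q a A -> arr_mx P Q b A -> a = b.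
Proof.
case: a b => [x y f lf bf] [x' y' h lh bh] tQ /= Qy xx' yy'.
case: x' / xx' h lh bh; case: y' / yy' => h lh bh aA bA.
have fh : f = h.
  apply/funext => v; apply: (bij_inj (triv_bij tQ Qy)).
  by have := aA v; have := bA v => /= -> ->.
case: h / fh lh bh bA => lh bh _.
by rewrite (Prop_irrelevance lh lf) (Prop_irrelevance bh bf).
Qed.

(** The two matrices of a loop are conjugate by the transition matrices at its base point. *)
Lemma arr_mx_trace_unique P Q a A B : trivs V P -> trivs V Q ->
  gl_src a = gl_tgt a -> triv_dom P (gl_src a) -> triv_dom Q (gl_src a) ->
  arr_mx P P a A -> arr_mx Q Q a B -> \tr A = \tr B.
Proof.
move=> tP tQ aa Pa Qa aA aB.
have [T _ TE] := triv_smooth tP tQ; have [T' _ TE'] := triv_smooth tQ tP.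
have aA' : arr_mx P P a (T' (gl_src a) *m B *m T (gl_src a)).
  move=> v; rewrite -!mulmxA -TE // -aB aa -TE' //; first by rewrite -aa.
  by rewrite -aa.
(* Both sides are matrices of the unit arrow in [Q]. *)
have TT : T (gl_src a) *m T' (gl_src a) = 1%:M.
  apply: (arr_mx_inj Q Q (gl_id V (gl_src a))) => //=; last exact: arr_mx_id.
  by move=> v; rewrite -mulmxA -TE' // -TE.
rewrite (arr_mx_inj _ _ _ _ _ tP Pa aA aA') -mulmxA mxtrace_mulC -mulmxA TT.
by rewrite mulmx1.
Qed.
End ArrowMatrixEq.

(** * Homomorphisms from [K] and their conjugates *)

(** Near a composable pair, [gcomp] agrees on composable pairs with a map [h] continuous on an open
    set, and all pairs [(f l, g l)] are composable. *)
Lemma gcomp_continuous (R : realType) (G : groupoidData R)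
    (K : topologicalType) (f g : K -> arr G) :
  is_lie_groupoid G -> continuous f -> continuous g ->
  (forall k, src (f k) = tgt (g k)) ->
  continuous (fun k => gcomp (f k) (g k)).
Proof.
move=> [_ [_ _ _ [_ _ _ smg] _]] cf cg fg k.
have [U [h [oU Uk [ch _] hE]]] := smg (f k, g k) (fg k).
have fgk : (fun l => (f l, g l)) @ k --> (f k, g k).
  exact: cvg_pair (cf k) (cg k).
have {}hE l : U (f l, g l) -> gcomp (f l) (g l) = h (f l, g l).
  by move=> Ul; apply: (hE (f l, g l)); rewrite inE; split => //; exact: fg.
move=> N; rewrite (hE k Uk).
move=> /(ch _ Uk) /fgk hN.
have UN : nbhs k [set l | U (f l, g l)].
  exact: (fgk _ (open_nbhs_nbhs (conj oU Uk))).
have {}hN : nbhs k [set l | N (h (f l, g l))] by exact: hN.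
by apply: filterS2 UN hN => l Ul /=; rewrite -hE.
Qed.

Lemma conj_act_homs (R : realType) (G : groupoidData R)
    (K : groupTopologicalType) (g : arr G) (phi : K -> arr G) :
  is_lie_groupoid G -> homs K G phi -> src g = base_point phi ->
  homs K G (conj_act g phi).
Proof.
move=> LG [cphi [x [sx tx mx]]]; rewrite /base_point sx => gx.
have [[_ Gst Ga Gid Ginv] _] := LG; have [si ti iv vi] := Ginv g.
have sgp k : src (gcomp g (phi k)) = x by rewrite (Gst _ _ _).1 ?gx ?tx ?sx.
have tgp k : tgt (gcomp g (phi k)) = tgt g by rewrite (Gst _ _ _).2 ?gx ?tx.
split.
  apply: gcomp_continuous => //; last by move=> k; rewrite sgp ti gx.
    by apply: gcomp_continuous => //; [move=> k; exact: cvg_cst|move=> k; rewrite gx tx].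
  by move=> k; exact: cvg_cst.
exists (tgt g); split => [k|k|k l]; rewrite /conj_act.
- by rewrite (Gst _ _ _).1 ?sgp ?ti ?gx.
- by rewrite (Gst _ _ _).2 ?tgp // sgp ti gx.
have sg_inv j : src (gcomp (gcomp g (phi j)) (invarr g)) = tgt g.
  by rewrite (Gst _ _ _).1 ?sgp ?ti ?gx.
rewrite Ga ?sg_inv ?tgp ?sgp ?ti ?gx //; congr (gcomp _ (invarr g)).
(* Regrouping brings [invarr g] and [g] together between [phi k] and [phi l], where they cancel. *)
rewrite -Ga ?sgp ?ti ?gx ?si ?tgp // (Ga (invarr g)) ?si ?gx ?tx // vi gx.
by rewrite -(tx l) (Gid (phi l)).2 mx Ga ?gx ?tx ?sx.
Qed.

(** * The character of a homomorphism into the groupoid *)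

Section Representation.
Context {R : realType} {G : groupoidData R} {d : nat}.
Context {V : vectorBundle (ob G) d} {K : groupTopologicalType}.
Variable r : arr G -> arr (GL V).
Hypothesis LG : is_lie_groupoid G.
Hypothesis rep_r : is_representation r.

(** One trivialization serves all [k], as every [phi k] is a loop at the base point when [phi] is in
    [homs]. *)
Definition has_character (phi : K -> arr G) (chi : K -> R[i]) : Prop :=
  exists P, [/\ trivs V P, triv_dom P (base_point phi) &
    forall k, exists2 A, arr_mx P P (r (phi k)) A & chi k = \tr A].

Lemma rep_src g : gl_src (r g) = src g.
Proof. by have [_ _ st _ _] := rep_r; have [] := st g. Qed.

Lemma rep_tgt g : gl_tgt (r g) = tgt g.
Proof. by have [_ _ st _ _] := rep_r; have [] := st g. Qed.

Lemma homs_base (phi : K -> arr G) : homs K G phi ->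
  forall k, src (phi k) = base_point phi /\ tgt (phi k) = base_point phi.
Proof. by move=> [_ [x [sx tx _]]] k; rewrite /base_point !sx tx. Qed.

(** [homs] asks for multiplicativity only, but the idempotent arrow [phi 1] can be cancelled by its
    inverse. *)
Lemma homs1 (phi : K -> arr G) : homs K G phi ->
  phi 1%g = idarr (base_point phi).
Proof.
move=> hphi; have [s1 t1] := homs_base _ hphi 1%g.
have [_ [_ [_ _ mx]]] := hphi.
have [[_ Gst Ga Gid Ginv] _] := LG; have [si ti iv vi] := Ginv (phi 1%g).
have pp : gcomp (phi 1%g) (phi 1%g) = phi 1%g by rewrite -mx mulg1.
rewrite -[LHS](Gid _).2 t1 -[X in idarr X]s1 -vi -Ga ?si ?s1 ?t1 //.
by rewrite pp vi s1.
Qed.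

Lemma rep_mx_exists (phi : K -> arr G) P : homs K G phi -> trivs V P ->
  triv_dom P (base_point phi) ->
  exists A : K -> 'M[R[i]]_d, forall k, arr_mx P P (r (phi k)) (A k).
Proof.
move=> hphi tP Px.
have /choice[A AE] : forall k, exists A, arr_mx P P (r (phi k)) A.
  move=> k; have [sk tk] := homs_base _ hphi k.
  by apply: arr_mx_exists; rewrite ?rep_src ?rep_tgt ?sk ?tk.
by exists A.
Qed.

Definition arr_mx_in P (W : set 'rV[R]_(d * d + d * d)) : set (arr G) :=
  [set g | [/\ triv_dom P (src g), triv_dom P (tgt g) &
    exists2 A, arr_mx P P (r g) A & W (mx_coords A)]].

Lemma arr_mx_in_open P W : trivs V P -> open W -> open (arr_mx_in P W).
Proof.
move=> tP oW; have [_ [_ [obM _ _] _ _ _]] := LG; have [_ [cr _] _ _ _] := rep_r.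
have := open_comp (fun g _ => cr g I) (arr_mx_open obM P P W tP tP oW).
rewrite /arr_mx_in; congr open; apply/seteqP.
by split=> g /= [? ? ?]; split; rewrite ?rep_src ?rep_tgt // -?rep_src -?rep_tgt.
Qed.

Lemma rep_mx_group_representation (phi : K -> arr G) P
    (A : K -> 'M[R[i]]_d) : homs K G phi -> trivs V P ->
  triv_dom P (base_point phi) ->
  (forall k, arr_mx P P (r (phi k)) (A k)) -> is_group_representation A.
Proof.
move=> hphi tP Px AE; have [cphi [x [sx tx mx]]] := hphi.
have Ps k : triv_dom P (gl_src (r (phi k))).
  by rewrite rep_src (homs_base _ hphi k).1.
have [_ [cr _] _ rid rM] := rep_r.
split.
- apply: (arr_mx_inj _ _ _ _ _ tP (Ps 1%g) (AE 1%g)).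
  by rewrite homs1 // rid; exact: arr_mx_id.
- move=> k l; apply: (arr_mx_inj _ _ _ _ _ tP (Ps (k * l)%g) (AE (k * l)%g)).
  rewrite mx rM ?sx ?tx //; apply: arr_mx_comp (AE k) (AE l).
  by rewrite rep_src rep_tgt sx tx.
(* Continuity: where [phi] takes values in the open set [arr_mx_in P W], the coordinates of [A] lie
   in [W]. *)
move=> k N; rewrite nbhsE => -[W [oW Wk] WN].
have Zk : arr_mx_in P W (phi k).
  by split; rewrite ?(homs_base _ hphi k).1 ?(homs_base _ hphi k).2 //; exists (A k).
have kZ : nbhs k (phi @^-1` arr_mx_in P W).
  exact: (cphi k _ (open_nbhs_nbhs (conj (arr_mx_in_open P W tP oW) Zk))).
apply: filterS kZ => l [_ _ [B lB WB]]; apply: WN.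
by rewrite /= (arr_mx_inj _ _ _ _ _ tP (Ps l) (AE l) lB).
Qed.

(** * Constancy of the character on [homs_of rho] *)

Hypothesis hausK : hausdorff_space K.
Hypothesis cptK : compact [set: K].

(** Around each [k] a compact-open condition on [psi] controls the traces on a compact neighborhood
    of [k]; compactness of [K] makes this uniform. *)
Lemma near_trace_close (phi : {compact-open, K -> arr G}) P
    (A : K -> 'M[R[i]]_d) : homs K G phi -> trivs V P ->
  triv_dom P (base_point phi) ->
  (forall k, arr_mx P P (r (phi k)) (A k)) ->
  \forall psi \near phi, forall k, triv_dom P (src (psi k)) /\
    exists2 B, arr_mx P P (r (psi k)) B & `|\tr (A k) - \tr B| <= 2^-1.
Proof.
move=> hphi tP Px AE.
pose close (psi : {compact-open, K -> arr G}) k := triv_dom P (src (psi k)) /\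
    exists2 B, arr_mx P P (r (psi k)) B & `|\tr (A k) - \tr B| <= 2^-1.
suff closeT : \forall psi \near phi, [set: K] `<=` close psi.
  by apply: filterS closeT => psi h k; apply: h.
have /compact_near_coveringP cov := cptK; apply: (cov _ (nbhs phi) close (nbhs_filter phi)) => k _.
(* Radius 1/4, as [A l] and the matrix of [psi l] are compared through [A k]. *)
pose W := [set w : 'rV[R]_(d * d + d * d) |
  `|(\tr (A k) : complexField R) - \tr (mx_of_coords R d w)| < 2^-1 / 2].
have oW : open W by apply: open_mxtrace_ball.
have Wk : arr_mx_in P W (phi k).
  split; rewrite ?(homs_base _ hphi k).1 ?(homs_base _ hphi k).2 //.
  by exists (A k) => //; rewrite /W /= mx_coordsK subrr normr0 divr_gt0 ?invr_gt0.
have oU := arr_mx_in_open P W tP oW.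
have [cphi _] := hphi.
(* Regularity puts the whole closure of [N] in the preimage; being compact, it defines an open set
   of the compact-open topology. *)
have [N kN NU] := @compact_regular K k setT hausK cptK filterT
  _ (cphi k _ (open_nbhs_nbhs (conj oU Wk))).
have cN : compact (closure N).
  by apply: (subclosed_compact _ cptK) => //; exact: closed_closure.
have near_phi : nbhs phi [set psi | psi @` closure N `<=` arr_mx_in P W].
  apply: open_nbhs_nbhs; split; first exact: compact_open_open.
  by move=> _ [l Nl <-]; apply: NU.
exists (N, [set psi | psi @` closure N `<=` arr_mx_in P W]) => //.
move=> [l psi] /= [Nl psiN].
have [Pl _ [B lB WB]] := psiN _ (imageP psi (subset_closure Nl)).
split => //; exists B => //.
have [_ _ [B0 lB0 WB0]] := NU _ (subset_closure Nl).
have Ps : triv_dom P (gl_src (r (phi l))).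
  by rewrite rep_src (homs_base _ hphi l).1.
have AB : A l = B0 by apply: (arr_mx_inj _ _ _ _ _ tP Ps (AE l) lB0).
move: WB WB0; rewrite /W /= !mx_coordsK AB => WB WB0.
have -> : \tr B0 - \tr B = (\tr (A k) - \tr B) - (\tr (A k) - \tr B0) by ring.
apply: le_trans (ler_normB _ _) _.
by apply: le_trans (lerD (ltW WB) (ltW WB0)) _; rewrite -splitr.
Qed.

(** The characters of [phi] and of a nearby homomorphism are uniformly within 1/2, hence equal by
    [character_eq_of_close]. *)
Lemma has_character_near (phi : {compact-open, K -> arr G}) chi :
  homs K G phi -> has_character phi chi ->
  \forall psi \near phi, homs K G psi -> has_character psi chi.
Proof.
move=> hphi [P [tP Px chiE]].
have [A AE] := rep_mx_exists _ _ hphi tP Px.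
apply: filterS (near_trace_close _ _ _ hphi tP Px AE) => psi near_psi hpsi.
have Py : triv_dom P (base_point psi) by have [] := near_psi 1%g.
have [B BE] := rep_mx_exists _ _ hpsi tP Py.
exists P; split => // k; exists (B k) => //.
have [C kC ->] := chiE k.
have Ps g : src g = base_point phi -> triv_dom P (gl_src (r g)) by rewrite rep_src => ->.
have Pt g : src g = base_point psi -> triv_dom P (gl_src (r g)) by rewrite rep_src => ->.
rewrite (arr_mx_inj _ _ _ _ _ tP (Ps _ (homs_base _ hphi k).1) kC (AE k)).
apply: (character_eq_of_close _ _ _ A B cptK) => [||l].
- exact: rep_mx_group_representation hphi tP Px AE.
- exact: rep_mx_group_representation hpsi tP Py BE.
have [_ [D lD]] := near_psi l.
by rewrite (arr_mx_inj _ _ _ _ _ tP (Pt _ (homs_base _ hpsi l).1) lD (BE l)).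
Qed.

Lemma has_character_exists phi : homs K G phi -> exists chi, has_character phi chi.
Proof.
move=> hphi.
have [P tP Px] := triv_cover V (base_point phi).
have [A AE] := rep_mx_exists _ _ hphi tP Px.
by exists (fun k => \tr (A k)), P; split => // k; exists (A k).
Qed.

Lemma has_character_unique phi chi chi' : homs K G phi ->
  has_character phi chi -> has_character phi chi' -> chi = chi'.
Proof.
move=> hphi [P [tP Px chiE]] [P' [tP' Px' chiE']]; apply/funext => k.
have [A kA ->] := chiE k; have [B kB ->] := chiE' k.
have [sk tk] := homs_base _ hphi k.
by apply: (arr_mx_trace_unique P P' (r (phi k))); rewrite ?rep_src ?rep_tgt ?sk ?tk.
Qed.

(** If [B] and [C] are the matrices of [g] and its inverse, the conjugate has matrix [B *m A *m C],
    with [C *m B = 1]. *)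
Lemma has_character_conj_act phi chi g : homs K G phi ->
  src g = base_point phi -> has_character phi chi ->
  has_character (conj_act g phi : K -> arr G) chi.
Proof.
move=> hphi gx [P [tP Px chiE]].
have [[_ Gst Ga Gid Ginv] _] := LG; have [si ti iv vi] := Ginv g.
have [_ _ _ rid rM] := rep_r.
have [Q tQ Qy] := triv_cover V (tgt g).
exists Q; split => // [|k].
  have [s1 t1] := homs_base _ hphi 1%g.
  by rewrite /base_point /conj_act !(Gst _ _ _).1 ?si // ?(Gst _ _ _).1 ?ti ?gx ?s1.
have [A kA ->] := chiE k; have [sk tk] := homs_base _ hphi k.
have [B gB] : exists B, arr_mx P Q (r g) B.
  by apply: arr_mx_exists; rewrite ?rep_src ?rep_tgt ?gx.
have [C gC] : exists C, arr_mx Q P (r (invarr g)) C.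
  by apply: arr_mx_exists; rewrite ?rep_src ?rep_tgt ?si ?ti ?gx.
have CB : C *m B = 1%:M.
  apply: (arr_mx_inj P P (gl_id V (src g))) => //=.
  - by rewrite gx.
  - have -> : gl_id V (src g) = gl_comp (r (invarr g)) (r g).
      by rewrite -[RHS]/(gcomp (r (invarr g)) (r g)) -rM ?si // vi rid.
    by apply: arr_mx_comp gC gB; rewrite rep_src rep_tgt si.
  - exact: arr_mx_id.
exists (B *m A *m C).
  rewrite /conj_act rM ?(Gst _ _ _).1 ?ti ?sk ?gx ?tk // rM ?gx ?tk //.
  apply: arr_mx_comp gC; last apply: arr_mx_comp gB kA.
    rewrite -rM ?gx ?tk // rep_src rep_tgt ti gx (Gst _ _ _).1 ?gx ?tk //.
  by rewrite rep_src rep_tgt gx tk.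
by rewrite -mulmxA mxtrace_mulC -mulmxA CB mulmx1.
Qed.

(** The times at which the character is [chi] form a nonempty, relatively open and closed subset of
    the connected interval. *)
Lemma has_character_path phi psi chi : has_character phi chi ->
  path_component R (homs K G) phi psi -> has_character psi chi.
Proof.
move=> phichi [gamma [cgamma g0 g1 hgamma]].
have cgam := (subspace_continuousP _ gamma).1 cgamma.
have near_gamma t chi' : `[0, 1]%classic t -> has_character (gamma t) chi' ->
    \forall s \near t, `[0, 1]%classic s -> has_character (gamma s) chi'.
  move=> It tchi.
  have : within `[0, 1]%classic (nbhs t)
      [set s | homs K G (gamma s) -> has_character (gamma s) chi'].
    exact: (cgam t It _ (has_character_near _ _ (hgamma t It) tchi)).
  by rewrite /within /=; apply: filterS => s h Is; apply: h => //; apply: hgamma.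
pose B := [set t : R | `[0, 1]%classic t /\ has_character (gamma t) chi].
have BE : B = `[0, 1]%classic.
  apply: (@segment_connected R 0 1).
  - exists 0; split; first by rewrite /= in_itv /= lexx ler01.
    by rewrite g0.
  (* The interior of a set defined by an implication expresses openness relative to the interval. *)
  - exists (interior [set t : R | `[0, 1]%classic t -> has_character (gamma t) chi]).
      exact: open_interior.
    apply/seteqP; split=> t [It]; first by move=> /(near_gamma _ _ It).
    by move=> /nbhs_singleton h; split => //; apply: h.
  exists (~` interior [set t : R | `[0, 1]%classic t -> ~ has_character (gamma t) chi]).
    by apply: open_closedC; exact: open_interior.
  apply/seteqP; split=> t [It tchi]; split => //.
    by move=> /nbhs_singleton /(_ It).
  (* A different character at [t] would persist nearby, so that [t] would lie in the interior just
     excluded. *)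
  have [chi' tchi'] := has_character_exists _ (hgamma t It).
  have [<- //|chichi'] := pselect (chi' = chi).
  exfalso; apply: tchi; apply: filterS (near_gamma _ _ It tchi') => s h Is schi.
  by apply: chichi'; apply: has_character_unique (hgamma s Is) (h Is) schi.
have : B 1 by rewrite BE /= in_itv /= lexx ler01.
by rewrite /B /= g1 => -[].
Qed.

(** The homomorphisms with character [chi] form a saturated set containing [rho], and [homs_of rho]
    is the smallest one. *)
Lemma has_character_homs_of rho chi : homs K G rho -> has_character rho chi ->
  forall phi, homs_of rho phi -> has_character phi chi.
Proof.
move=> hrho rhochi phi.
suff : homs_of rho `<=` [set psi | homs K G psi /\ has_character psi chi].
  by move=> sub /sub[].
apply: smallest_sub; last by move=> _ ->.
split=> [psi [] //|psi [hpsi psichi] psi' psipsi'|g psi [hpsi psichi] gpsi].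
  split; last exact: has_character_path psichi psipsi'.
  have [gamma [_ _ <- hgamma]] := psipsi'.
  by apply: hgamma; rewrite /= in_itv /= lexx ler01.
by split; [apply: conj_act_homs|apply: has_character_conj_act].
Qed.
End Representation.

Theorem theorem12 (R : realType) (G : groupoidData R) (K : lieGroup R)
    (rho : K -> arr G) :
  is_lie_groupoid G -> faithfully_representable G ->
  compact [set: K] ->
  homs K G rho -> injective rho ->
  exists2 chi : K -> R[i], faithful_character chi &
    forall mu, Mon rho mu -> chi \o mu = chi.
Proof.
move=> LG [d [V [r [rep_r inj_r]]]] cptK hrho inj_rho.
have hausK : hausdorff_space K by have [] := lg_manifold K.
have [P tP Px] := triv_cover V (base_point rho).
have [A AE] := rep_mx_exists r rep_r _ _ hrho tP Px.
have rhochi : has_character r rho (fun k => \tr (A k)).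
  by exists P; split => // k; exists (A k).
have chiE := has_character_homs_of r LG rep_r hausK cptK _ _ hrho rhochi.
exists (fun k => \tr (A k)).
  exists d, A; split => //; first exact: rep_mx_group_representation LG rep_r _ _ _ hrho tP Px AE.
  (* The loops [rho k] and [rho l] have the same base point, so equality of their matrices
     identifies their images under [r]. *)
  move=> k l Akl; apply: inj_rho; apply: inj_r.
  apply: (arr_mx_eq P P _ _ (A k) tP); rewrite ?rep_src ?rep_tgt //;
    rewrite ?(homs_base _ hrho _).1 ?(homs_base _ hrho _).2 //.
  by rewrite Akl.
move=> mu [[nu [_ _ cmu _ mmu]] homsmu].
(* Since [rho] lies in [homs_of rho], so does [rho \o mu]; its character is then that of [rho], and
   also that of [rho] composed with [mu]. *)
have rhomu : homs_of rho (rho \o mu : {compact-open, K -> arr G}).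
  rewrite -homsmu; exists rho => //.
  by move=> S [_ rhoS]; apply: rhoS.
have mu_chi := chiE _ rhomu.
have hmu : has_character r (rho \o mu) ((fun k => \tr (A k)) \o mu).
  exists P; split=> [||k] //; last by exists (A (mu k)) => //; exact: (AE (mu k)).
  have [smu _] := homs_base _ hrho (mu 1%g).
  by rewrite -[base_point _]/(src (rho (mu 1%g))) smu.
have hrhomu : homs K G (rho \o mu).
  have [crho [x [sx tx mx]]] := hrho; split.
    by move=> k; apply: continuous_comp; [exact: cmu|exact: crho].
  by exists x; split => *; rewrite /= ?sx ?tx // mmu mx.
exact: has_character_unique hrhomu hmu mu_chi.
Qed.
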